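(* Let $G=(V,E)$ be any finite simple undirected graph with $V\neq\emptyset$. Then: (i) for every coalition game $\mathcal G$ over the interaction graph $G$, $\dfrac{\kappa(\mathcal G)}{\rho(\mathcal G)}\le \tau(G)$; (ii) there exists a coalition game $\mathcal G$ over the interaction graph $G$ with $\dfrac{\kappa(\mathcal G)}{\rho(\mathcal G)}\ge \tau(G)$. Hence the maximum of the packing-covering ratio $\kappa(\mathcal G)/\rho(\mathcal G)$ over all coalition games on $G$ equals $\tau(G)$.
   Context: Coalition game over an interaction graph: for a finite simple undirected graph $G=(V,E)$, a coalition game $\mathcal G$ over $G$ is given by a valuation $v:2^V\to\mathbb Z_{\ge 0}$ such that $v(\emptyset)=0$, $v(S)=0$ whenever the induced subgraph $G[S]$ is disconnected, and $v$ is not identically zero. Define $\kappa^f(\mathcal G)=\min\{\sum_{i\in V}x_i : x\in\mathbb R_{\ge0}^V,\ \sum_{i\in S}x_i\ge v(S)\ \forall S\subseteq V\}$ and $\kappa(\mathcal G)$ the same minimum over $x\in\mathbb Z_{\ge 0}^V$; $\rho^f(\mathcal G)=\max\{\sum_{S\subseteq V}v(S)y_S : y\ge 0,\ \sum_{S\ni i}y_S\le 1\ \forall i\in V\}$ and $\rho(\mathcal G)$ the same maximum over $y\in\{0,1\}^{2^V}$ (i.e. the maximum of $\sum v(S)$ over families of pairwise disjoint subsets $S$). Thicket: a finite collection $\mathcal H$ of nonempty subsets of $V$ such that each member induces a connected subgraph of $G$ and any two members intersect. A hitting set of $\mathcal H$ is a vertex set meeting every member; the hitting size $\tau(\mathcal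 H)$ is the minimum cardinality of a hitting set. The thicket number $\tau(G)$ is the maximum of $\tau(\mathcal H)$ over all thickets $\mathcal H$ of $G$. *)

(* Defs.v *)
From mathcomp Require Import all_boot all_order all_algebra.
Set Implicit Arguments. Unset Strict Implicit. Unset Printing Implicit Defensive.

Section Defs.
Variables (T : finType) (e : rel T).

Definition induced_connected (S : {set T}) : bool :=
  (S != set0) &&
  [forall x in S, forall y in S,
     connect (fun a b => [&& a \in S, b \in S & e a b]) x y].

Definition coalition_game (v : {set T} -> nat) : Prop :=
  [/\ v set0 = 0%N,
      (forall S : {set T}, S != set0 -> ~~ induced_connected S -> v S = 0%N)
    & exists S : {set T}, v S != 0%N].

Definition covers (v : {set T} -> nat) (x : T -> nat) : Prop :=
  forall S : {set T}, (v S <= \sum_(i in S) x i)%N.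

Definition is_kappa (v : {set T} -> nat) (k : nat) : Prop :=
  (exists x : T -> nat, covers v x /\ \sum_(i : T) x i = k) /\
  (forall x : T -> nat, covers v x -> (k <= \sum_(i : T) x i)%N).

Definition rho (v : {set T} -> nat) : nat :=
  \max_(F : {set {set T}} | trivIset F) \sum_(S in F) v S.

Definition thicket (H : {set {set T}}) : bool :=
  [forall A in H, induced_connected A] &&
  [forall A in H, forall B in H, A :&: B != set0].

Definition hits (X : {set T}) (H : {set {set T}}) : bool :=
  [forall A in H, X :&: A != set0].

(* Minimum cardinality of a hitting set (setT, of size #|T|, is a hitting set
   of every family of nonempty sets, so #|T| is a harmless seed). *)
Definition hitting_size (H : {set {set T}}) : nat :=
  \big[minn/#|T|]_(X : {set T} | hits X H) #|X|.

Definition thicket_number : nat :=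
  \max_(H : {set {set T}} | thicket H) hitting_size H.

End Defs.

(* Main.v *)
Require Import Defs.
From mathcomp Require Import all_boot all_order all_algebra.
From mathcomp Require Import zify.
Import Order.TTheory GRing.Theory Num.Theory.
Local Open Scope ring_scope.
(** The bound rests on a duality in the style of Seymour and Thomas, with bags
    of size at most [k] where an edge may also join two adjacent bags: if every
    thicket is hit by [k] vertices, the graph has such a tree decomposition.
    One proves more generally that for every downward closed family [s] of
    vertex sets there is a rooted decomposition whose leaves may be any members
    of [s], by induction on the complement of [s].  If the connected sets
    outside [s] pairwise intersect, they form a thicket, and a hitting set of it
    is a single bag with all components in [s].  Otherwise take disjoint minimal
    non-members [C] and [D].  By induction there are decompositions over
    [C |: s] and [D |: s]; reroot them at the leaves [C] and [D], restrict each
    one to one side of a minimum [C]-[D] separator [Z], replacing the part of a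
    bag beyond [Z] by the vertices of [Z] that it cuts off from [C] (or [D]),
    and glue along [Z].  Minimality of [Z] keeps the bags small.

    Given a game and a decomposition with trivial leaves, let [W] be a lowest
    bag such that [W] with the components [D] below it contains a valued
    coalition.  Raising the payoff of the vertices of [W] by one lowers the
    packing number: a packing avoiding [W] has nothing in [D], so it can be
    augmented inside [D :|: W].  Iterating gives a cover of weight at most [k]
    times the packing number.  The indicator game of a thicket of maximum
    hitting size is tight. *)

Set Implicit Arguments. Unset Strict Implicit. Unset Printing Implicit Defensive.

(** * Components and reachability *)

Section Components.
Local Open Scope nat_scope.
Context (T : finType) (e : rel T) (e_sym : symmetric e).
Implicit Types (U V K C D W Z S : {set T}) (x y z : T).

(** As [connect] is reflexive, this is the singleton of [x] when [x] is outside [U]. *)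
Definition cc U x : {set T} :=
  [set y | connect (fun a b => [&& a \in U, b \in U & e a b]) x y].

Lemma cc_refl U x : x \in cc U x.
Proof. by rewrite inE connect0. Qed.

Lemma cc_step U x y z :
  y \in cc U x -> y \in U -> z \in U -> e y z -> z \in cc U x.
Proof.
rewrite !inE => xy yU zU yz; apply: connect_trans xy (connect1 _).
by rewrite yU zU.
Qed.

Lemma cc_min U x K : x \in K ->
  (forall y z, y \in K -> y \in U -> z \in U -> e y z -> z \in K) ->
  cc U x \subset K.
Proof.
move=> xK clK; apply/subsetP => y; rewrite inE => /connectP[p].
elim: p x xK => [|a p IH] x xK /=; first by move=> _ ->.
case/andP=> /and3P[xU aU xa] pth yE; apply: (IH a) => //.
exact: clK x a xK xU aU xa.
Qed.

Lemma cc_sub U x : x \in U -> cc U x \subset U.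
Proof. by move=> xU; apply: cc_min. Qed.

Lemma ccC_notin W x y : x \notin W -> y \in cc (~: W) x -> y \notin W.
Proof. by rewrite -in_setC => /cc_sub/subsetP sub /sub; rewrite inE. Qed.

Lemma cc_eq U x y : y \in cc U x -> cc U y = cc U x.
Proof.
have sym : connect_sym (fun a b => [&& a \in U, b \in U & e a b]).
  by apply: sym_connect_sym => a b; rewrite e_sym andbCA.
rewrite inE => xy; apply/setP => z; rewrite !inE.
by rewrite (same_connect sym xy).
Qed.

Lemma cc_mono U V x : U \subset V -> cc U x \subset cc V x.
Proof.
move/subsetP=> UV; apply: cc_min; first exact: cc_refl.
move=> y z yV yU zU; apply: cc_step; rewrite ?UV //.
Qed.

Lemma cc_shrink U V x : U \subset V -> cc V x \subset U -> cc U x = cc V x.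
Proof.
move=> UV /subsetP VU; apply/eqP; rewrite eqEsubset cc_mono //=.
have sub : cc U x \subset cc V x by exact: cc_mono.
apply: cc_min; first exact: cc_refl.
move=> y z yx yV zV yz; have yVx := subsetP sub _ yx.
have zVx := cc_step yVx yV zV yz.
exact: (cc_step yx (VU _ yVx) (VU _ zVx) yz).
Qed.

Lemma cc_connected U x : x \in U -> induced_connected e (cc U x).
Proof.
move=> xU; apply/andP; split; first by apply/set0Pn; exists x; apply: cc_refl.
apply/forall_inP => y yx; apply/forall_inP => z zx.
suff : z \in cc (cc U x) y by rewrite inE.
have Ex : cc (cc U x) x = cc U x by apply: cc_shrink; rewrite ?cc_sub.
by rewrite (@cc_eq (cc U x) x y) Ex.
Qed.

Lemma connected_sub_cc S U x :
  induced_connected e S -> S \subset U -> x \in S -> S \subset cc U x.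
Proof.
case/andP=> _ /forall_inP cS SU xS; apply/subsetP => y yS.
apply: (subsetP (cc_mono x SU)); rewrite inE.
by move/forall_inP: (cS x xS); apply.
Qed.

Definition reach C U : {set T} := \bigcup_(x in C :&: U) cc U x.

Lemma reach_refl C U x : x \in C -> x \in U -> x \in reach C U.
Proof. by move=> xC xU; apply/bigcupP; exists x; rewrite ?cc_refl // inE xC. Qed.

Lemma reach_sub C U : reach C U \subset U.
Proof. by apply/bigcupsP => x /setIP[_ /cc_sub]. Qed.

Lemma reach_step C U y z : y \in reach C U -> z \in U -> e y z -> z \in reach C U.
Proof.
move=> yR zU yz; have yU := subsetP (reach_sub C U) _ yR.
case/bigcupP: yR => x xC yx; apply/bigcupP; exists x => //.
exact: (cc_step yx yU zU yz).
Qed.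

Lemma reach_cc C U y z : y \in reach C U -> z \in cc U y -> z \in reach C U.
Proof.
by case/bigcupP=> x xC yx; rewrite (cc_eq yx) => zx; apply/bigcupP; exists x.
Qed.

Lemma reachP C U y :
  reflect (exists2 x, x \in C & x \in cc U y /\ y \in U) (y \in reach C U).
Proof.
apply: (iffP bigcupP) => [[x /setIP[xC xU] yx]|[x xC [xy yU]]].
  exists x => //; split; last exact: (subsetP (cc_sub xU)).
  by rewrite (cc_eq yx) cc_refl.
exists x; last by rewrite (cc_eq xy) cc_refl.
by rewrite inE xC (subsetP (cc_sub yU)).
Qed.

Definition separates C D Z := [disjoint reach C (~: Z) & D].

Lemma separatesC C D Z : separates C D Z = separates D C Z.
Proof.
suff sub A B : separates A B Z -> separates B A Z by apply/idP/idP; apply: sub.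
rewrite /separates => /pred0P dis; apply/pred0P => x /=; apply/negP.
case/andP=> /reachP[y yB [yx xZ]] xA; have := dis y; rewrite /= yB andbT.
by rewrite (reach_cc (reach_refl xA _) yx).
Qed.

(** * Rooted decompositions with bags of size at most [k] and leaves in [s] *)

Variable k : nat.
Implicit Type s : {set {set T}}.

(* [W] is the root bag of a decomposition of [K].  An edge of the graph may
   join two adjacent bags, hence [K :|: W] need not contain the neighbours of [K]. *)
Inductive decomp s : {set T} -> Prop :=
| decomp_leaf K : K \in s -> decomp s K
| decomp_node K W : #|W| <= k ->
    (forall x, x \in K -> x \notin W -> cc (~: W) x \subset K) ->
    (forall x, x \in K -> x \notin W -> decomp s (cc (~: W) x)) ->
    decomp s K.

Definition decomposable s :=
  exists2 W : {set T}, #|W| <= k & forall x, x \notin W -> decomp s (cc (~: W) x).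

(** A decomposition of the whole graph in which [K] hangs from the root bag as a leaf that need not
    belong to [s]. *)
Definition decomposable_except s K :=
  exists W : {set T}, [/\ #|W| <= k, exists2 x, x \notin W & K = cc (~: W) x
    & forall y, y \notin W -> y \notin K -> decomp s (cc (~: W) y)].

(** Every set below [K] in the decomposition is contained in [K], so none can be the leaf [C]. *)
Lemma decomp_drop_leaf s C K :
  decomp (C |: s) K -> ~~ (C \subset K) -> decomp s K.
Proof.
elim=> [{}K|{}K W Wk sub _ IH] CK.
  case/setU1P: CK => [<- | Ks _]; last exact: decomp_leaf.
  by rewrite subxx.
apply: (@decomp_node _ _ W) => // x xK xW; apply: IH => //.
by apply: contra CK => /subset_trans; apply; apply: sub.
Qed.

Lemma decomp_reroot s C K : C != set0 -> decomp (C |: s) K ->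
  decomposable_except s K -> decomposable s \/ decomposable_except s C.
Proof.
move=> C0; elim=> [{}K KsC|{}K W Wk sub dec IH] [W0 [W0k [x0 x0W0 K_def] dec0]].
  case/setU1P: KsC => [<- | Ks].
    by right; exists W0; split=> //; exists x0.
  left; exists W0 => // y yW0; have [yK|] := boolP (y \in K); last exact: dec0.
  by rewrite K_def in yK; rewrite (cc_eq yK) -K_def; apply: decomp_leaf.
have [/exists_inP[x /setDP[xK xW] Cx]|noC] :=
    boolP [exists x in K :\: W, C \subset cc (~: W) x]; last first.
  left; exists W0 => // y yW0; have [yK|] := boolP (y \in K); last exact: dec0.
  rewrite K_def in yK; rewrite (cc_eq yK) -K_def.
  apply: (@decomp_node _ _ W) => // x xK xW.
  apply: (decomp_drop_leaf (dec x xK xW)); apply: contra noC => Cx.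
  by apply/exists_inP; exists x => //; rewrite inE xW.
(* Vertices of [W] beyond the boundary of [K] are useless for [K] *)
pose W1 := W :&: (K :|: W0).
have W1W : W1 \subset W by exact: subsetIl.
have W1P y : y \in K -> y \notin W1 -> y \notin W.
  by move=> yK; rewrite !inE yK andbT.
have KW0 y z : y \in K -> e y z -> z \notin W0 -> z \in K.
  rewrite K_def => yK yz zW0; apply: (cc_step yK _ _ yz); rewrite inE //.
  exact: ccC_notin yK.
(* Leaving [K] means entering [W0], where [W1] keeps all of [W]; hence trimming does not change the
   components inside [K]. *)
have ccE y : y \in K -> y \notin W -> cc (~: W1) y = cc (~: W) y.
  move=> yK yW; apply/esym/cc_shrink; first by rewrite setCS.
  apply: subset_trans (_ : K :\: W \subset _); last by rewrite setDE subsetIr.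
  apply: cc_min => [|a b]; first by rewrite inE yW.
  case/setDP=> aK aW _ bW1 ab.
  have [bK|bK] := boolP (b \in K); first by rewrite inE bK W1P //; rewrite inE in bW1.
  have bW0 : b \in W0 by apply: contraNT bK; apply: KW0 ab.
  have bW : b \notin W by move: bW1; rewrite !inE bW0 orbT andbT.
  case/negP: bK; apply: (subsetP (sub a aK aW)).
  by apply: (cc_step (cc_refl _ _) _ _ ab); rewrite inE.
apply: (IH x xK xW); exists W1; split.
- exact: leq_trans (subset_leq_card W1W) Wk.
- exists x; last by rewrite ccE.
  by apply: contra xW; apply: (subsetP W1W).
move=> y yW1 yx; have [yK|yK] := boolP (y \in K).
  have yW := W1P _ yK yW1; rewrite ccE //.
  apply: (decomp_drop_leaf (dec y yK yW)); apply/negP => Cy.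
  case/set0Pn: C0 => c cC; case/negP: yx.
  rewrite -(cc_eq (subsetP Cx c cC)) (cc_eq (subsetP Cy c cC)); exact: cc_refl.
have offK z : z \in cc (~: W1) y -> z \notin K.
  move=> zy; apply/negP => zK.
  have zW1 : z \notin W1 by exact: ccC_notin zy.
  have zW := W1P _ zK zW1; case/negP: yK; apply: (subsetP (sub z zK zW)).
  by rewrite -ccE // (cc_eq zy) cc_refl.
(* Outside [K] the old decomposition survives, with [W0] as the bag below [W1]. *)
apply: (@decomp_node _ _ W0) => // u uy uW0; last first.
  by apply: dec0 => //; apply: offK.
rewrite -(cc_eq uy).
have uK := offK _ uy.
apply: subset_trans (_ : cc (~: W0) u \subset cc (~: W0 :&: ~: K) u) _; last first.
  by apply: cc_mono; rewrite -setCU setCS setUC; apply: subsetIr.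
suff -> : cc (~: W0 :&: ~: K) u = cc (~: W0) u by [].
apply: cc_shrink; first exact: subsetIl.
apply: cc_min => [|a b]; rewrite !inE ?uW0 // => /andP[aW0 aK] _ bW0 ab.
rewrite bW0; apply: contra aK => bK; apply: (KW0 b) => //; by rewrite e_sym.
Qed.

(** * Gluing two decompositions along a minimum separator *)

Section Glue.
Variables (s : {set {set T}}) (C D Z M : {set T}).
Hypothesis s_down : forall A B : {set T}, B \subset A -> A \in s -> B \in s.
Hypothesis sepZ : separates C D Z.
Hypothesis minZ : forall Y : {set T}, separates C D Y -> #|Z| <= #|Y|.

(** [M] is the side of [Z] away from [C]; the decomposition with [C] as a leaf gets restricted to
    it. *)
Hypothesis M_def : M = ~: (Z :|: reach C (~: Z)).

Let in_M x : (x \in M) = (x \notin Z) && (x \notin reach C (~: Z)).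
Proof. by rewrite M_def !inE negb_or. Qed.

Let cut W := (W :&: M) :|: (Z :\: reach C (~: (M :|: W))).

Let in_cut x W : x \in M -> (x \in cut W) = (x \in W).
Proof.
move=> xM; move: (xM); rewrite in_M !inE xM andbT => /andP[/negPf-> _].
by rewrite andbF orbF.
Qed.

Lemma side_disjoint x : x \in M -> x \notin C.
Proof.
rewrite in_M => /andP[xZ]; apply: contra => xC.
by apply: reach_refl; rewrite ?inE.
Qed.

(** The vertices of [Z] that [C] reaches within [~: (M :|: W)], together with [W :\: M], separate
    [C] from [D]. By minimality of [Z], its remaining vertices are no more numerous than [W :\: M],
    which they replace. *)
Lemma card_cut W : #|cut W| <= #|W|.
Proof.
pose X := reach C (~: (M :|: W)); pose Y := (Z :&: X) :|: (W :\: M).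
have sepY : separates C D Y.
  apply: contraTT sepZ; rewrite /separates => /pred0Pn[d /= /andP[/bigcupP[c]]].
  case/setIP=> cC; rewrite inE => cY dc dD.
  have inY a : a \notin M -> a \notin Y -> a \in ~: (M :|: W).
    by move=> aM; rewrite !inE !(negPf aM) negb_or /= => /andP[].
  have XY a : a \in X -> a \notin Y -> a \in X :\: Z.
    by move=> aX; rewrite !inE aX andbT negb_or => /andP[-> _].
  have cX : c \in X.
    have cM : c \notin M by apply: contraL cC; apply: side_disjoint.
    by apply: reach_refl (inY _ cM cY).
  (* A path from [C] that avoids [Y] stays in [X] and off [Z], so its reaching [D] would contradict
     [sepZ]. *)
  have sub : cc (~: Y) c \subset X :\: Z.
    apply: cc_min => [|a b]; first exact: XY.
    case/setDP=> aX aZ _; rewrite inE => bY ab; apply: (XY _ _ bY).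
    apply: (reach_step aX _ ab); apply: (inY _ _ bY).
    rewrite in_M negb_and !negbK; case: (boolP (b \in Z)) => //= bZ.
    apply: (reach_step _ _ ab); last by rewrite inE.
    have := subsetP (reach_sub _ _) _ aX.
    by rewrite !inE negb_or in_M aZ /= negbK => /andP[].
  have cZ : c \notin Z by have /setDP[] := subsetP sub c (cc_refl _ _).
  apply/pred0Pn; exists d => /=; rewrite dD andbT.
  apply/bigcupP; exists c; first by rewrite !inE cC.
  rewrite -(@cc_shrink (~: Y :&: ~: Z)) in dc.
  - exact: subsetP (cc_mono c (subsetIr _ _)) d dc.
  - exact: subsetIl.
  have cYC : c \in ~: Y by rewrite in_setC.
  rewrite subsetI cc_sub //=; apply: (subset_trans sub).
  by rewrite setDE subsetIr.
have := minZ sepY; have := cardsID X Z; have := cardsID M W.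
have := (leq_card_setU (Z :&: X) (W :\: M)).1.
have := (leq_card_setU (W :&: M) (Z :\: X)).1.
rewrite /cut -/X -/Y; lia.
Qed.

(** A component can leave [M] only through [Z]. A vertex of [Z] outside [cut W] is joined to [C] off
    [W], so a component missing [C] cannot pass through it. *)
Lemma cc_cut W u : u \in M -> u \notin W -> [disjoint cc (~: W) u & C] ->
  cc (~: cut W) u = cc (cc (~: W) u :&: M) u.
Proof.
move=> uM uW dis; apply/esym/cc_shrink.
  apply/subsetP => y /setIP[yu yM].
  by rewrite inE in_cut // (ccC_notin uW yu).
apply: cc_min => [|a b]; first by rewrite inE cc_refl.
case/setIP=> au aM _; rewrite inE => bcut ab.
have aW : a \notin W by exact: ccC_notin au.
have bZ : b \notin Z.
  apply/negP => bZ.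
  have : b \in reach C (~: (M :|: W)).
    by apply: contraNT bcut => bX; rewrite !inE bZ bX orbT.
  case/reachP=> c cC [cb]; rewrite !inE negb_or => /andP[_ bW].
  have bu : b \in cc (~: W) u by apply: (cc_step au _ _ ab); rewrite inE.
  move/pred0P/(_ c): dis; rewrite /= cC andbT -(cc_eq bu) => /negP; apply.
  apply: (subsetP (cc_mono b _) c cb); by rewrite setCS subsetUr.
have bM : b \in M.
  rewrite in_M bZ; apply: contraL aM => bR.
  rewrite in_M negb_and !negbK; case: (boolP (a \in Z)) => //= aZ.
  by apply: (reach_step bR); rewrite ?inE // e_sym.
have bW : b \notin W by rewrite -in_cut.
by rewrite inE bM andbT; apply: (cc_step au _ _ ab); rewrite inE.
Qed.

Lemma decomp_cut A : decomp s A -> [disjoint A & C] ->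
  forall u, u \in A -> u \in M -> decomp s (cc (A :&: M) u).
Proof.
elim=> [{}A As|{}A W Wk sub _ IH] dis u uA uM.
  apply: decomp_leaf; apply: s_down As.
  by apply: subset_trans (cc_sub _) (subsetIl _ _); rewrite inE uA.
have inAM x : x \in cc (A :&: M) u -> (x \in A) && (x \in M).
  by move=> xu; rewrite -in_setI (subsetP (cc_sub _) x xu) // inE uA.
have main x : x \in cc (A :&: M) u -> x \notin cut W ->
    [/\ x \in A, x \in M, x \notin W, [disjoint cc (~: W) x & C]
      & cc (~: cut W) x = cc (cc (~: W) x :&: M) x].
  move=> xu xcut; have /andP[xA xM] := inAM x xu.
  have xW : x \notin W by rewrite -in_cut.
  have dx : [disjoint cc (~: W) x & C] by apply: disjointWl dis; apply: sub.
  by split=> //; apply: cc_cut.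
apply: (@decomp_node _ _ (cut W)); first exact: leq_trans (card_cut W) Wk.
  move=> x xu xcut; have [xA xM xW dx ->] := main x xu xcut.
  by rewrite -(cc_eq xu); apply: cc_mono; apply: setSI; apply: sub.
move=> x xu xcut; have [xA xM xW dx ->] := main x xu xcut.
by apply: IH => //; rewrite cc_refl.
Qed.

Lemma decomp_side x : decomposable_except s C ->
  x \in M -> decomp s (cc (~: Z) x).
Proof.
case=> W [Wk [c cW C_def] dec] xM.
have MZ : M \subset ~: Z by rewrite M_def setCS subsetUl.
have inM u : u \in cc (~: Z) x -> u \in M.
  move=> ux; have xZ : x \notin Z by move: xM; rewrite in_M => /andP[].
  rewrite in_M (ccC_notin xZ ux) /=.
  apply: contraL xM => uR; rewrite in_M (reach_cc uR) ?andbF //.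
  by rewrite (cc_eq ux) cc_refl.
have main u : u \in cc (~: Z) x -> u \notin cut W ->
    [/\ u \in M, u \notin W, [disjoint cc (~: W) u & C]
      & cc (~: cut W) u = cc (cc (~: W) u :&: M) u].
  move=> ux ucut; have uM := inM u ux.
  have uW : u \notin W by rewrite -in_cut.
  (* [M] avoids [C], so the component of [u] is not the component [C]. *)
  have du : [disjoint cc (~: W) u & C].
    apply/pred0P => y /=; apply/negP => /andP[yu]; rewrite C_def => yc.
    by case/negP: (side_disjoint uM); rewrite C_def -(cc_eq yc) (cc_eq yu) cc_refl.
  by split=> //; apply: cc_cut.
apply: (@decomp_node _ _ (cut W)); first exact: leq_trans (card_cut W) Wk.
  move=> u ux ucut; have [uM uW du ->] := main u ux ucut.
  by rewrite -(cc_eq ux); apply/cc_mono/(subset_trans _ MZ)/subsetIr.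
move=> u ux ucut; have [uM uW du ->] := main u ux ucut.
apply: decomp_cut => //; last exact: cc_refl.
by apply: dec => //; apply: side_disjoint.
Qed.

End Glue.

Lemma decomposable_glue s C D :
  (forall A B : {set T}, B \subset A -> A \in s -> B \in s) ->
  [disjoint C & D] -> decomposable_except s C -> decomposable_except s D ->
  decomposable s.
Proof.
move=> s_down CD decC decD.
have [W [Wk [c cW C_def] _]] := decC.
(* [C] is a whole component of [~: W], so nothing outside [C] is reached from it; a minimum
   separator thus has at most [k] vertices. *)
have sepW : separates C D W.
  apply: disjointWl CD; apply/bigcupsP => x /setIP[xC _].
  by rewrite C_def in xC; rewrite (cc_eq xC) -C_def.
case: (arg_minnP (fun Z => #|Z|) sepW) => Z sepZ minZ.
exists Z; first exact: leq_trans (minZ W sepW) Wk.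
move=> x xZ; have [xC|xC] := boolP (x \in reach C (~: Z)); last first.
  by apply: (decomp_side s_down sepZ minZ erefl decC); rewrite !inE negb_or xZ.
apply: (@decomp_side s D C Z _ s_down _ _ erefl _ decD).
- by rewrite separatesC.
- by move=> Y; rewrite separatesC; apply: minZ.
rewrite !inE negb_or xZ; apply/negP => /reachP[d dD [dx _]].
by move/pred0P/(_ d): sepZ; rewrite /= dD (reach_cc xC dx).
Qed.

(** * From small hitting sets to decompositions *)

Lemma thickets_hit_decomposable s :
  (forall H, thicket e H -> exists2 W : {set T}, hits W H & #|W| <= k) ->
  set0 \in s -> (forall A B : {set T}, B \subset A -> A \in s -> B \in s) ->
  decomposable s.
Proof.
move=> hit; have [n] := ubnP #|~: s|; elim: n s => // n IH s sn s0 s_down.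
have add (A : {set T}) : A \notin s -> exists2 C : {set T}, C \subset A &
    C != set0 /\ (decomposable s \/ decomposable_except s C).
  move=> As; have [C /minsetP[/= Cs Cmin] CA] :=
    @minset_exists _ (fun B => B \notin s) A As.
  exists C => //; have C0 : C != set0 by apply: contraNneq Cs => ->.
  (* Minimality of [C] keeps [C |: s] downward closed, so the induction hypothesis applies. *)
  split=> //; have [W Wk dec] : decomposable (C |: s).
    apply: IH; first last.
    - move=> B B' sub /setU1P[EB|Bs]; last by rewrite inE (s_down B) ?orbT.
      rewrite EB in sub; rewrite inE; apply/orP.
      have [B's|B's] := boolP (B' \in s); first by right.
      by left; rewrite inE (Cmin B').
    - by rewrite inE s0 orbT.
    have := proper_card (_ : ~: (C |: s) \proper ~: s).
    rewrite ltnS in sn; move=> lt; apply: leq_trans (lt _) sn.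
    apply/properP; split; first by rewrite setCS subsetUr.
    by exists C; rewrite !inE ?eqxx.
  have [/existsP[x /andP[xW Cx]]|noC] :=
      boolP [exists x, (x \notin W) && (C \subset cc (~: W) x)].
    apply: (decomp_reroot C0 (dec x xW)).
    exists W; split=> //; first by exists x.
    move=> y yW yx; apply: (decomp_drop_leaf (dec y yW)); apply/negP => Cy.
    case/set0Pn: C0 => c cC; case/negP: yx.
    by rewrite -(cc_eq (subsetP Cx c cC)) (cc_eq (subsetP Cy c cC)) cc_refl.
  left; exists W => // x xW; apply: (decomp_drop_leaf (dec x xW)).
  by apply: contra noC => Cx; apply/existsP; exists x; rewrite xW.
have [/existsP[A /existsP[B /and3P[As Bs AB]]]|nodis] :=
    boolP [exists A, exists B, [&& A \notin s, B \notin s & [disjoint A & B]]].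
  have [C CA [_ [//|decC]]] := add A As; have [D DB [_ [//|decD]]] := add B Bs.
  apply: decomposable_glue decC decD => //.
  exact: disjointWl CA (disjointWr DB AB).
pose H := [set K | induced_connected e K && (K \notin s)].
have [|W hW Wk] := hit H.
  apply/andP; split; apply/forall_inP => A; rewrite inE => /andP[cA As] //.
  apply/forall_inP => B; rewrite inE => /andP[cB Bs].
  rewrite setI_eq0; apply: contra nodis => AB.
  by apply/existsP; exists A; apply/existsP; exists B; rewrite As Bs.
exists W => // x xW; apply: decomp_leaf; apply: contraLR hW => ccs.
rewrite negb_forall; apply/existsP; exists (cc (~: W) x).
rewrite negb_imply inE ccs cc_connected ?inE //= negbK setI_eq0.
by rewrite disjoint_sym disjoints_subset cc_sub // inE.
Qed.

End Components.

(** * Coalition games *)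

Section Games.
Local Open Scope nat_scope.
Context (T : finType) (e : rel T) (e_sym : symmetric e).
Implicit Types (v : {set T} -> nat) (H : {set {set T}}) (S W D : {set T}).

Lemma bigminn_le (I : finType) (P : pred I) (F : I -> nat) m i :
  P i -> \big[minn/m]_(j | P j) F j <= F i.
Proof.
move=> Pi; rewrite -big_filter.
have : i \in [seq j <- index_enum I | P j] by rewrite mem_filter Pi mem_index_enum.
elim: [seq j <- _ | _] => // j r IH; rewrite inE big_cons geq_min.
by case/predU1P=> [->|/IH ->]; rewrite ?leqnn ?orbT.
Qed.

Lemma hitting_size_le H W : hits W H -> hitting_size H <= #|W|.
Proof. exact: (@bigminn_le _ (fun X => hits X H) (fun X : {set T} => #|X|)). Qed.

(** The hypothesis lets [setT] account for the seed [#|T|] of the minimum. *)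
Lemma hitting_size_attained H : hits setT H ->
  exists2 W : {set T}, hits W H & #|W| <= hitting_size H.
Proof.
move=> hitT; rewrite /hitting_size; elim/big_ind: _ => [|m n [A hA Am] [B hB Bn]|W hW].
- by exists setT; rewrite ?cardsT.
- by case: leqP => _; [exists A | exists B].
- by exists W.
Qed.

Lemma thicket_hit H : thicket e H ->
  exists2 W : {set T}, hits W H & #|W| <= thicket_number e.
Proof.
move=> tH; have [|W hW Wle] := @hitting_size_attained H.
  apply/forall_inP => A AH; rewrite setTI.
  by case/andP: tH => /forall_inP/(_ A AH)/andP[].
exists W => //; apply: leq_trans Wle _.
exact: (@leq_bigmax_cond _ (thicket e) (@hitting_size T) H tH).
Qed.

(** * Integral covers from decompositions *)

Definition null_on v D := [forall S : {set T}, (S \subset D) ==> (v S == 0)].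

Lemma null_onP v D : reflect (forall S, S \subset D -> v S = 0) (null_on v D).
Proof.
by apply: (iffP forall_inP) => nul S SD; apply/eqP; [apply: nul | rewrite nul].
Qed.

(** Nonvanishing is left out of [coalition_game] because the values are lowered repeatedly and may
    all become zero. *)
Definition supported_on_connected v :=
  v set0 = 0 /\ forall S, S != set0 -> ~~ induced_connected e S -> v S = 0.

Lemma null_on_components v D : supported_on_connected v ->
  (forall x, x \in D -> null_on v (cc e D x)) -> null_on v D.
Proof.
case=> v0 vconn nul; apply/null_onP => S SD.
have [->//|/set0Pn[x xS]] := eqVneq S set0.
have [cS|cS] := boolP (induced_connected e S); last first.
  by apply: vconn cS; apply/set0Pn; exists x.
apply: (null_onP _ _ (nul x _)); first exact: (subsetP SD).
exact: connected_sub_cc.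
Qed.

(* Descending the decomposition from the root, stop at a lowest bag [W] that
   together with the components [D] below it contains a valued coalition. *)
Lemma decomposable_bag k v S : supported_on_connected v -> v S != 0 ->
  decomposable e k [set set0] ->
  exists W D, [/\ #|W| <= k, forall y z, y \in D -> z \notin W -> e y z -> z \in D,
    [disjoint D & W], null_on v D & ~~ null_on v (D :|: W)].
Proof.
move=> vs vS decT.
pose good (W D : {set T}) := [&& #|W| <= k,
  [forall y in D, forall z, (z \notin W) ==> e y z ==> (z \in D)],
  [disjoint D & W], null_on v D & ~~ null_on v (D :|: W)].
have [/existsP[W /existsP[D /and5P[Wk /forall_inP clD DW nD nDW]]]|none] :=
    boolP [exists W, exists D, good W D].
  exists W, D; split=> // y z yD zW yz.
  by have /forallP/(_ z) := clD y yD; rewrite zW yz.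
(* Without a good bag, nullity passes from the components below [W] up to [K]; starting from empty
   leaves, it would reach [setT]. *)
have step (K W : {set T}) : #|W| <= k ->
    (forall x, x \in K -> x \notin W -> cc e (~: W) x \subset K) ->
    (forall x, x \in K -> x \notin W -> null_on v (cc e (~: W) x)) ->
    null_on v K.
  move=> Wk sub nul; apply: contraNT none => nK.
  apply/existsP; exists W; apply/existsP; exists (K :\: W).
  rewrite /good Wk /=; apply/and4P; split.
  - apply/forall_inP => y /setDP[yK yW]; apply/forallP => z.
    apply/implyP => zW; apply/implyP => yz; rewrite inE zW.
    apply: (subsetP (sub y yK yW)).
    by apply: (cc_step (cc_refl _ _ _) _ _ yz); rewrite inE.
  - by rewrite disjoint_sym disjoints_subset setCD subsetUr.
  - apply: null_on_components => // x /setDP[xK xW].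
    apply/null_onP => S' S'x; apply: (null_onP _ _ (nul x xK xW)).
    apply: subset_trans S'x _; apply: cc_mono; by rewrite setDE subsetIr.
  - apply: contra nK => /null_onP nul'; apply/null_onP => S' S'K; apply: nul'.
    apply: (subset_trans S'K); apply/subsetP => x xK; rewrite !inE xK.
    by case: (x \in W).
have dec_null (K : {set T}) : decomp e k [set set0] K -> null_on v K.
  elim=> [{}K|{}K W Wk sub _ nul]; last exact: step nul.
  rewrite inE => /eqP->; apply/null_onP => S'; rewrite subset0 => /eqP->.
  by case: vs.
case/eqP: vS; case: decT => W Wk dec.
have nT : null_on v setT.
  apply: (step setT W) => // x _ xW; last exact: dec_null (dec x xW).
by move/null_onP: nT; apply; apply: subsetT.
Qed.

Lemma leq_rho v (F : {set {set T}}) : trivIset F -> \sum_(S in F) v S <= rho v.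
Proof. exact: (@leq_bigmax_cond _ (@trivIset T) (fun F => \sum_(S in F) v S)). Qed.

Lemma rho_pay_bag v W D S : supported_on_connected v ->
  (forall y z, y \in D -> z \notin W -> e y z -> z \in D) ->
  [disjoint D & W] -> null_on v D -> S \subset D :|: W -> v S != 0 ->
  rho (fun A => v A - #|A :&: W|) < rho v.
Proof.
move=> [v0 vconn] clD DW nD SDW vS; pose v' A := v A - #|A :&: W|.
have v'v A : v' A <= v A by exact: leq_subr.
have S0 : S != set0 by apply: contra vS => /eqP->; rewrite v0.
suff gain F : trivIset F -> \sum_(A in F) v' A < rho v.
  (* Positivity, from the empty packing, turns the strict bound on each packing into one on the
     maximum. *)
  have rho_gt0 : 0 < rho v.
    by apply: leq_trans (gain set0 _); rewrite // /trivIset /cover !big_set0 cards0.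
  rewrite -(prednK rho_gt0) ltnS; apply/bigmax_leqP => F /gain.
  by rewrite -{1}(prednK rho_gt0).
move=> tF.
(* A member meeting [W] whose truncated value is still nonzero has strictly lost value. *)
have [/exists_inP[A AF /andP[vA AW]]|noA] :=
    boolP [exists A in F, (v' A != 0) && (A :&: W != set0)].
  apply: leq_trans (leq_rho v tF); rewrite (bigD1 A) //= [X in _ < X](bigD1 A) //=.
  rewrite -addSn leq_add ?leq_sum //.
  rewrite /v' in vA *; rewrite -cards_eq0 in AW; lia.
pose F1 := [set A in F | v' A != 0].
have F1S A : A \in F1 -> [disjoint A & S].
  rewrite inE => /andP[AF vA].
  have AW : [disjoint A & W].
    rewrite -setI_eq0; apply: contraNT noA => AW.
    by apply/exists_inP; exists A; rewrite ?vA.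
  have vA0 : v A != 0 by apply: contra vA => /eqP E; rewrite /v' E.
  have A0 : A != set0 by apply: contra vA0 => /eqP->; rewrite v0.
  have cA : induced_connected e A by apply: contraNT vA0 => /vconn->.
  apply/pred0P => x /=; apply/negP => /andP[xA xS].
  have xW : x \notin W by apply/negP => xW; move/pred0P/(_ x): AW; rewrite /= xA xW.
  have xD : x \in D by have := subsetP SDW x xS; rewrite inE (negPf xW) orbF.
  (* [A] is connected, misses [W] and meets [D], so it cannot leave [D], where [v] vanishes. *)
  have AD : A \subset D.
    apply: subset_trans (_ : cc e (~: W) x \subset D).
      by apply: connected_sub_cc => //; rewrite -disjoints_subset.
    apply: cc_min => // y z yD _; rewrite inE => zW; exact: clD.
  by case/eqP: vA0; apply: (null_onP _ _ nD).
have S1 : S \notin F1.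
  by apply/negP => /F1S; rewrite -setI_eq0 setIid (negPf S0).
have tF1 : trivIset (S |: F1).
  apply/trivIsetP => A B /setU1P[->|AF] /setU1P[->|BF]; rewrite ?eqxx // => AB.
  - by rewrite disjoint_sym F1S.
  - exact: F1S.
  - move/trivIsetP: tF; apply=> //.
      by move: AF; rewrite inE => /andP[].
    by move: BF; rewrite inE => /andP[].
apply: leq_trans (leq_rho v tF1); rewrite big_setU1 //= -add1n leq_add ?lt0n //.
rewrite (bigID (fun A => v' A == 0)) /= big1 ?add0n; last by move=> A /andP[_ /eqP].
rewrite [X in _ <= X]big_mkcond [X in X <= _]big_mkcond leq_sum // => A _.
by rewrite inE; case: (A \in F); case: (v' A == 0) => //=.
Qed.

Lemma covers_rho k v :
  (forall H, thicket e H -> exists2 W : {set T}, hits W H & #|W| <= k) ->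
  supported_on_connected v ->
  exists2 x : T -> nat, covers v x & \sum_i x i <= k * rho v.
Proof.
move=> hit; move: {2}(rho v).+1 (ltnSn (rho v)) => n.
elim: n v => // n IH v vn vs.
have [nul|] := boolP (null_on v setT).
  exists (fun _ => 0); last by rewrite big1.
  by move=> S; rewrite (null_onP _ _ nul) ?subsetT.
rewrite negb_forall => /existsP[S]; rewrite negb_imply => /andP[_ vS].
have decT : decomposable e k [set set0].
  apply: thickets_hit_decomposable => //; first by rewrite inE.
  by move=> A B BA; rewrite !inE => /eqP A0; rewrite -subset0 -A0.
have [W [D [Wk clD DW nD]]] := decomposable_bag vs vS decT.
rewrite negb_forall => /existsP[S']; rewrite negb_imply => /andP[S'DW vS'].
have lt := rho_pay_bag vs clD DW nD S'DW vS'.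
have [||x xcov xle] := IH (fun A => v A - #|A :&: W|).
- exact: leq_trans lt vn.
- by case: vs => v0 vconn; split=> [|A A0 cA]; rewrite ?v0 ?vconn.
exists (fun i => x i + (i \in W)) => [A|].
  have := xcov A; rewrite big_split /= leq_subLR addnC => /leq_trans-> //.
  rewrite leq_add2l -sum1_card big_mkcond [X in _ <= X]big_mkcond leq_sum // => i _.
  by rewrite inE; case: (i \in A).
rewrite big_split /= -big_mkcond /= sum1_card.
apply: leq_trans (leq_add xle Wk) _; rewrite addnC -mulnS leq_mul2l lt orbT //.
Qed.

(** Each payoff is bounded by the total, so covers of total [n] form a finite search space and a
    least total can be extracted. *)
Lemma is_kappa_exists v x : covers v x -> exists k, is_kappa v k.
Proof.
move=> xcov.
pose P n := [exists y : {ffun T -> 'I_n.+1},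
  [forall S : {set T}, v S <= \sum_(i in S) y i] && (\sum_i y i == n)].
have PI y : covers v y -> P (\sum_i y i).
  move=> ycov; have yE i : (inord (y i) : 'I_(\sum_i y i).+1) = y i :> nat.
    by rewrite inordK // ltnS (bigD1 i) //= leq_addr.
  apply/existsP; exists [ffun i => inord (y i)]; apply/andP; split.
    by apply/forallP => S; under eq_bigr => i _ do rewrite ffunE yE.
  by under eq_bigr => i _ do rewrite ffunE yE.
have exP : exists n, P n by exists (\sum_i x i); apply: PI.
case: (ex_minnP exP) => n /existsP[y /andP[/forallP ycov /eqP yn]] nmin.
exists n; split; first by exists (fun i => y i : nat).
by move=> z zcov; apply/nmin/PI.
Qed.

Lemma rho_gt0 v S : v S != 0 -> 0 < rho v.
Proof.
rewrite -lt0n => vS; apply: leq_trans vS _.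
have := @leq_rho v [set S]; rewrite big_set1; apply.
by apply/trivIsetP => A B /set1P-> /set1P->; rewrite eqxx.
Qed.

Lemma kappa_le_thicket_number v : coalition_game e v ->
  exists k, is_kappa v k /\ k <= thicket_number e * rho v.
Proof.
case=> v0 vconn _; have [|//|x xcov xle] := @covers_rho (thicket_number e) v.
  exact: thicket_hit.
have [k kap] := is_kappa_exists xcov; exists k; split=> //.
by case: kap => _ /(_ x xcov) /leq_trans; apply.
Qed.

(** * Tightness: the game of an optimal thicket *)

Lemma thicket_number_attained : 0 < #|T| ->
  exists H, [/\ thicket e H, H != set0 & thicket_number e = hitting_size H].
Proof.
case/card_gt0P=> x _.
have t1 : thicket e [set [set x]].
  apply/andP; split; apply/forall_inP => A /set1P->; last first.
    apply/forall_inP => B /set1P->; rewrite setIid; apply/set0Pn; exists x; exact: set11.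
  apply/andP; split; first by apply/set0Pn; exists x; exact: set11.
  by apply/forall_inP => y /set1P->; apply/forall_inP => z /set1P->; apply: connect0.
(* The empty thicket has hitting size 0, so positivity forces a maximizing thicket to be
   nonempty. *)
have pos : 0 < thicket_number e.
  apply: leq_trans (_ : 0 < hitting_size [set [set x]]) (leq_bigmax_cond _ t1).
  have [|W hW] := @hitting_size_attained [set [set x]].
    by apply/forall_inP => A /set1P->; rewrite setTI; apply/set0Pn; exists x; exact: set11.
  apply: leq_trans; rewrite card_gt0.
  by move/forall_inP: hW => /(_ _ (set11 _)); apply: contraNneq => ->; rewrite set0I.
have [|H tH EH] := @eq_bigmax_cond _ (thicket e) (@hitting_size T).
  by apply/card_gt0P; exists [set [set x]].
exists H; split=> //; apply: contraTneq pos => H0; rewrite -leqNgt.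
rewrite /thicket_number EH H0 -(cards0 T); apply: hitting_size_le.
by apply/forall_inP => A; rewrite inE.
Qed.

Lemma thicket_game_rho H : thicket e H -> rho (fun S => S \in H : nat) <= 1.
Proof.
case/andP=> _ /forall_inP inter; apply/bigmax_leqP => F tF.
have [/exists_inP[A AF AH]|none] := boolP [exists A in F, A \in H]; last first.
  rewrite big1 // => A AF; apply/eqP; rewrite eqb0; apply: contra none => AH.
  by apply/exists_inP; exists A.
rewrite (bigD1 A) //= AH big1 // => B /andP[BF BA]; apply/eqP; rewrite eqb0.
apply/negP => BH; have /forall_inP/(_ B BH) := inter A AH.
rewrite setI_eq0 => /negP; apply.
by move/trivIsetP: tF; apply=> //; rewrite eq_sym.
Qed.

(** The support of a cover is a hitting set, and each of its vertices is paid at least one. *)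
Lemma thicket_game_covers H x : covers (fun S => S \in H : nat) x ->
  hitting_size H <= \sum_i x i.
Proof.
move=> xcov; apply: (@leq_trans #|[set i | x i != 0]|).
  apply: hitting_size_le; apply/forall_inP => A AH; apply/set0Pn.
  have := xcov A; rewrite AH lt0n sum_nat_eq0 negb_forall => /existsP[i].
  by rewrite negb_imply => /andP[iA xi]; exists i; rewrite !inE xi.
rewrite -sum1_card big_mkcond leq_sum // => i _; rewrite inE; case: (x i) => //.
Qed.

Lemma thicket_game H : thicket e H -> H != set0 ->
  coalition_game e (fun S => S \in H : nat).
Proof.
case/andP=> /forall_inP conn _ /set0Pn[A AH]; split.
- apply/eqP; rewrite eqb0; apply/negP => /conn /andP[]; by rewrite eqxx.
- by move=> S _ cS; apply/eqP; rewrite eqb0; apply: contra cS; apply: conn.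
- by exists A; rewrite AH.
Qed.

End Games.

Theorem theorem1 (T : finType) (e : rel T)
    (e_sym : symmetric e) (e_irr : irreflexive e) (V_nonempty : (0 < #|T|)%N) :
  (forall v : {set T} -> nat, coalition_game e v ->
     exists k : nat, is_kappa v k /\
       (k%:R / (rho v)%:R <= (thicket_number e)%:R :> rat)) /\
  (exists v : {set T} -> nat, coalition_game e v /\
     exists k : nat, is_kappa v k /\
       ((thicket_number e)%:R <= k%:R / (rho v)%:R :> rat)).
Proof.
split=> [v game|].
  have [k [kap kle]] := kappa_le_thicket_number e_sym game; exists k; split=> //.
  case: game => _ _ [S vS].
  (* [rho v] is positive, so the quotient is not the default value of division by zero. *)
  by rewrite ler_pdivrMr ?ltr0n ?(rho_gt0 vS) // -natrM ler_nat.
have [H [tH H0 ->]] := thicket_number_attained e V_nonempty.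
have game := thicket_game tH H0; exists (fun S => S \in H : nat); split=> //.
have [k [kap _]] := kappa_le_thicket_number e_sym game; exists k; split=> //.
have -> : rho (fun S => S \in H : nat) = 1%N.
  apply/eqP; rewrite eqn_leq (thicket_game_rho tH) /=.
  by case: game => _ _ [S vS]; apply: rho_gt0 vS.
rewrite divr1 ler_nat; case: kap => [[x [xcov <-]] _].
exact: thicket_game_covers.
Qed.
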